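(* Let $d \in 2\mathbb{N}$ and let $g \in \mathbb{Z}\setminus\{-1\}$ be such that $g \neq b^{h}$ for all $b,h \in \mathbb{Z}$ with $h \geq 2$. Write $g = g_0 g_s^2$ with $g_0 \in \mathbb{Z}$ square-free and $g_s \in \mathbb{Z}$. Then $[d,g]=0$ (i.e. $[d,g]$ is not Artin admissible) if and only if one of the following conditions holds: 1. $g_0 = 5$ and $d \equiv 2, 3 \pmod 5$; 2. $g_0 \mid d$, and either (a) $d \equiv 2 \pmod 4$ and $g_0 \equiv 3 \pmod 4$, or (b) $d \equiv 4 \pmod 8$ and $g_0 \equiv 2 \pmod 4$; 3. $g_0 \nmid d$, $g_0 \mid 3d$, and either (a) $g_0 \equiv 1 \pmod 4$, or (b) $g_0 \equiv 3 \pmod 4$ and $d \equiv 0 \pmod 4$, or (c) $g_0 \equiv 2 \pmod 4$ and $d \equiv 0 \pmod 8$. In particular, if any of these conditions is satisfied, then $\pi_{d,g}$ is empty.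
   Context: For an odd positive integer $n$ and an integer $a$, $\left(\frac{a}{n}\right)$ denotes the Jacobi symbol. Let $\mathcal{P}$ be the set of odd primes, and for $g \in \mathbb{Z}$ let $\mathcal{P}_g$ be the set of odd primes $p$ such that $g \bmod p$ generates the cyclic group $(\mathbb{Z}/p\mathbb{Z})^{\times}$. Define $\pi_{d,g} := \{p : p \in \mathcal{P}_g \text{ and } p+d \in \mathcal{P}_g\}$. For odd $n \in \mathbb{N}$ define $\Delta_{d,g}(n) = 1$ if $\left(\frac{g}{n}\right) = \left(\frac{g}{n+d}\right) = -1$, and $\Delta_{d,g}(n)=0$ otherwise. The pair $[d,g]$ is called Artin admissible if $\Delta_{d,g}(n) = 1$ for infinitely many odd $n \in \mathbb{N}$; otherwise one writes $[d,g]=0$. Congruences and divisibility involving $g_0$ are taken for the integer $g_0$ (which may be negative). *)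

(* Defs.v *)
From mathcomp Require Import all_boot all_order all_fingroup all_algebra all_solvable.
From mathcomp Require Import classical_sets cardinality.

Set Implicit Arguments.
Unset Strict Implicit.
Unset Printing Implicit Defensive.

Import GRing.Theory.
Local Open Scope classical_set_scope.
Local Open Scope ring_scope.

(* Meant for an odd prime p. *)
Definition legendre (a : int) (p : nat) : int :=
  if (p %| a)%Z then 0
  else if [exists x : 'I_p, ((x%:Z ^+ 2 == a %[mod p])%Z)] then 1
  else -1.

(* Meant for an odd positive n; the empty product gives the value 1 at n = 1. *)
Definition jacobi (a : int) (n : nat) : int :=
  \prod_(p <- primes n) legendre a p ^+ logn p n.

(* Excludes 0, and allows negative integers. *)
Definition squarefree (a : int) : Prop :=
  forall k : int, (k ^+ 2 %| a)%Z -> `|k| = 1.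

(* P_g; 'Z_p is Z/pZ since p > 1. *)
Definition artin_primes (g : int) : set nat :=
  [set p | [/\ prime p, odd p &
     exists2 u : {unit 'Z_p}, val u = g%:~R & generator (units_Zp p) u]].

Definition artin_pairs (d : nat) (g : int) : set nat :=
  [set p | artin_primes g p /\ artin_primes g (p + d)%N].

Definition Delta (d : nat) (g : int) (n : nat) : nat :=
  if (jacobi g n == -1) && (jacobi g (n + d) == -1) then 1 else 0.

Definition artin_admissible (d : nat) (g : int) : Prop :=
  infinite_set [set n : nat | odd n /\ Delta d g n = 1%N].

Definition exceptional5 (d : nat) (g0 : int) : Prop :=
  g0 = 5 /\ (d = 2 %[mod 5] \/ d = 3 %[mod 5])%N.

Definition exceptional_dvd (d : nat) (g0 : int) : Prop :=
  (g0 %| d%:Z)%Z /\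
  ((d = 2 %[mod 4])%N /\ (g0 = 3 %[mod 4])%Z \/
   (d = 4 %[mod 8])%N /\ (g0 = 2 %[mod 4])%Z).

Definition exceptional_dvd3 (d : nat) (g0 : int) : Prop :=
  [/\ ~ (g0 %| d%:Z)%Z, (g0 %| 3 * d%:Z)%Z &
  [\/ (g0 = 1 %[mod 4])%Z,
      (g0 = 3 %[mod 4])%Z /\ (d = 0 %[mod 4])%N |
      (g0 = 2 %[mod 4])%Z /\ (d = 0 %[mod 8])%N]].

Definition exceptional (d : nat) (g0 : int) : Prop :=
  [\/ exceptional5 d g0, exceptional_dvd d g0 | exceptional_dvd3 d g0].

(* Main.v *)
Require Import Defs.
From mathcomp Require Import all_boot all_order all_fingroup all_algebra all_solvable.
From mathcomp Require Import all_field zify ring.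
From mathcomp Require Import boolp classical_sets cardinality.

(* Write g0 = (+-1) 2^e m with m odd and positive.  Quadratic reciprocity turns
   (g0 / n) into psi(n) * prod_(q | m) (n / q), where psi is a character modulo 8:
   it is trivial, (-1 / .), or one of (+-2 / .), according to g0 mod 4.  By the
   Chinese remainder theorem, the sign patterns ((g0 / n), (g0 / n + d)) are
   exactly the products of the patterns available at the places 2 and q | m.
   - If q divides d, the patterns at q are (+,+) and (-,-).
   - If q >= 7 does not divide d, all four patterns occur; at q = 5 exactly one is
     missing, namely (c, c) with c = (d / 5); at q = 3 only one pattern occurs, and
     its two signs differ.  This follows from sum_x chi(x) chi(x + d) = -1.
   - At 2, if psi is not trivial, the patterns are the two equal ones, the two
     unequal ones, or all four, according to d mod 8.
   The pattern (-,-) is missing from the product exactly in the listed cases. *)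

Set Implicit Arguments.
Unset Strict Implicit.
Unset Printing Implicit Defensive.

Import Order.TTheory GRing.Theory Num.Theory.
Local Open Scope ring_scope.

(** * The quadratic character of a finite field *)

(** Taken from Euler's criterion, so that multiplicativity is a power law; [quad_char_eq1] recovers
    squares. *)
Definition quad_char (F : finFieldType) (x : F) : int :=
  if x == 0 then 0 else if x ^+ (#|F|.-1)./2 == 1 then 1 else -1.

Lemma expf_card_pred (F : finFieldType) (x : F) : x != 0 -> x ^+ #|F|.-1 = 1.
Proof.
move=> x0; apply: (mulfI x0); rewrite mulr1 -exprS prednK ?expf_card //.
by apply/card_gt0P; exists x.
Qed.

Lemma card_pred_half (F : finFieldType) :
  odd #|F| -> (#|F|.-1)./2.*2 = #|F|.-1.
Proof. by move=> oF; have := odd_double_half #|F|.-1; lia. Qed.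

Lemma card_half_gt0 (F : finFieldType) : odd #|F| -> (0 < (#|F|.-1)./2)%N.
Proof.
by move=> oF; have c1 : (1 < #|F|)%N := finNzRing_gt1 F; have := card_pred_half oF; lia.
Qed.

Lemma quad_char_val (F : finFieldType) (x : F) :
  odd #|F| -> (quad_char x)%:~R = x ^+ (#|F|.-1)./2.
Proof.
move=> oF; rewrite /quad_char; have [->|x0] := eqVneq x 0.
  by rewrite expr0n; case: eqP => // h0; have := card_half_gt0 oF; rewrite h0.
case: eqP => [->//|h1]; apply/esym/eqP.
have : (x ^+ (#|F|.-1)./2) ^+ 2 == 1.
  by rewrite -exprM muln2 card_pred_half // expf_card_pred.
by rewrite sqrf_eq1 => /orP[/eqP//|/eqP->].
Qed.

(** The difference lies between -2 and 2, and no nonzero such integer dies in [R]. Identities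
    between symbols can thus be checked in characteristic p. *)
Lemma sign_inj (R : idomainType) (x y : int) : (2%:R : R) != 0 ->
  `|x| <= 1 -> `|y| <= 1 -> x%:~R = y%:~R :> R -> x = y.
Proof.
move=> n2 hx hy /eqP; rewrite -subr_eq0 -intrB => /eqP xy.
have n1 := oner_neq0 R.
have nN z : z%:~R != 0 :> R -> (- z)%:~R != 0 :> R by rewrite intrN oppr_eq0.
have e2 : (2%:~R : R) != 0 by [].
suff : x - y = 0 by lia.
have : x - y \in [:: 0; 1; 2; -1; -2] by rewrite !inE; lia.
rewrite !inE => /or4P[/eqP//|/eqP e|/eqP e|/orP[]/eqP e]; move: xy; rewrite e => /eqP.
- by rewrite (negPf n1).
- by rewrite (negPf e2).
- by rewrite (negPf (nN 1 n1)).
- by rewrite (negPf (nN 2 e2)).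
Qed.

Lemma quad_char_le1 (F : finFieldType) (x : F) : `|quad_char x| <= 1.
Proof. by rewrite /quad_char; do 2?case: ifP. Qed.

Lemma odd_card_two_neq0 (F : finFieldType) : odd #|F| -> (2%:R : F) != 0.
Proof.
move=> oF; apply/eqP => e2.
have : (#|F|%:R : F) = 0.
  (* Translation by 1 permutes [F], so the sum of all elements is unchanged by adding [#|F|]. *)
  have : \sum_(x : F) x = \sum_(x : F) (x + 1)  by exact: (reindex_inj (addIr 1)).
  rewrite big_split /= => /(congr1 (fun y => y - \sum_(x : F) x)).
  by rewrite subrr addrAC subrr add0r sumr_const.
rewrite -(odd_double_half #|F|) oF natrD -muln2 natrM e2 mulr0 addr0.
by move/eqP; rewrite oner_eq0.
Qed.

Lemma quad_charM (F : finFieldType) (x y : F) :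
  odd #|F| -> quad_char (x * y) = quad_char x * quad_char y.
Proof.
move=> oF; apply: (sign_inj (odd_card_two_neq0 oF)).
- exact: quad_char_le1.
- by rewrite normrM mulr_ile1 ?quad_char_le1.
- by rewrite intrM !quad_char_val // exprMn.
Qed.

Lemma quad_char1 (F : finFieldType) : quad_char (1 : F) = 1.
Proof. by rewrite /quad_char oner_eq0 expr1n eqxx. Qed.

Lemma quad_char0 (F : finFieldType) : quad_char (0 : F) = 0.
Proof. by rewrite /quad_char eqxx. Qed.

Lemma quad_char_sign (F : finFieldType) (x : F) : x != 0 ->
  quad_char x = 1 \/ quad_char x = -1.
Proof. by rewrite /quad_char => /negPf->; case: ifP; [left|right]. Qed.

Lemma quad_char_sqr (F : finFieldType) (x : F) : x != 0 ->
  quad_char x * quad_char x = 1.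
Proof. by move=> /quad_char_sign[]->. Qed.

Lemma field_unit_generator (F : finFieldType) : exists u : {unit F},
  [set: {unit F}] = <[u]>%g /\ #[u]%g = #|F|.-1.
Proof.
have /cyclicP[u uE] := field_unit_group_cyclic [set: {unit F}]%G.
by exists u; split=> //; rewrite orderE -uE card_finField_unit.
Qed.

Lemma quad_char_eq1 (F : finFieldType) (x : F) : odd #|F| -> x != 0 ->
  (quad_char x == 1) = [exists y : F, y ^+ 2 == x].
Proof.
move=> oF x0; have hE := card_pred_half oF.
have [u [uE ou]] := field_unit_generator F.
apply/idP/existsP => [|[y /eqP yx]]; last first.
  rewrite -yx expr2 quad_charM // quad_char_sqr //.
  by apply: contraNneq x0 => y0; rewrite -yx y0 expr0n.
rewrite /quad_char (negPf x0); case: ifP => // /eqP xh _.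
have ux : x \is a GRing.unit by rewrite unitfE.
have /cycleP[k xk] : FinRing.unit F ux \in <[u]>%g by rewrite -uE inE.
(* With [x] the [k]-th power of a generator, Euler's criterion forces [k] to be even. *)
have : (u ^+ (k * (#|F|.-1)./2) == 1)%g.
  by rewrite expgM -xk -val_eqE /= FinRing.val_unitX /= xh.
rewrite -order_dvdn ou -{1}hE -muln2 mulnC dvdn_pmul2r; last first.
  exact: card_half_gt0.
move=> /dvdnP[j kE]; exists (val (u ^+ j)%g).
by rewrite -FinRing.val_unitX -expgM -kE -xk.
Qed.

Lemma quad_char_nonresidue (F : finFieldType) : odd #|F| ->
  exists2 x : F, x != 0 & quad_char x = -1.
Proof.
move=> oF; have hE := card_pred_half oF.
have [u [uE ou]] := field_unit_generator F.
have u0 : val u != 0 by have := valP u; rewrite unitfE.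
exists (val u) => //; rewrite /quad_char (negPf u0); case: ifP => //.
rewrite -FinRing.val_unitX -[1]/(val (1%g : {unit F})) val_eqE -order_dvdn ou.
have h0 := card_half_gt0 oF; rewrite -hE => /dvdn_leq; lia.
Qed.

(** Multiplication by a nonresidue permutes [F] and negates every term. *)
Lemma sum_quad_char (F : finFieldType) : odd #|F| -> \sum_(x : F) quad_char x = 0.
Proof.
move=> oF; have [g g0 gN] := quad_char_nonresidue oF.
suff : \sum_(x : F) quad_char x = - \sum_(x : F) quad_char x by lia.
rewrite {1}(reindex_inj (mulfI g0)) /= -sumrN; apply: eq_bigr => x _.
by rewrite quad_charM // gN mulN1r.
Qed.

(** Replacing x by its inverse turns a nonzero term into chi(1 + d x); the full sum of these is 0,
    and x = 0 would contribute 1. *)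
Lemma sum_quad_char_shift (F : finFieldType) (d : F) : odd #|F| -> d != 0 ->
  \sum_(x : F) quad_char x * quad_char (x + d) = -1.
Proof.
move=> oF d0; rewrite (bigD1 0) //= quad_char0 mul0r add0r.
rewrite (reindex_inj (can_inj (@invrK F))) /=.
transitivity (\sum_(x | (x : F) != 0) quad_char (1 + d * x)).
  apply: eq_big => x; rewrite ?invr_eq0 // => x0.
  have -> : x^-1 + d = x^-1 * (1 + d * x) by field.
  by rewrite quad_charM // mulrA quad_char_sqr ?mul1r // invr_eq0.
have inj : injective (fun x : F => 1 + d * x) by move=> x y /addrI /(mulfI d0).
have := sum_quad_char oF; rewrite (reindex_inj inj) /= (bigD1 0) //=.
by rewrite mulr0 addr0 quad_char1 => /(canRL (addKr _)) ->.
Qed.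

(* If the pattern does not occur, then (1 + e chi(x)) (1 + f chi(x + d)) vanishes
   outside {0, -d}, while its sum over F is #|F| - e f. *)
Lemma quad_char_pattern (F : finFieldType) (d : F) (e f : int) :
    odd #|F| -> d != 0 -> e = 1 \/ e = -1 -> f = 1 \/ f = -1 ->
    #|F|%:Z - e * f != 2 + f * quad_char d + e * quad_char (- d) ->
  exists x : F, quad_char x = e /\ quad_char (x + d) = f.
Proof.
move=> oF d0 he hf hN.
have [/existsP[x /andP[/eqP ? /eqP ?]]|/existsPn hno] := boolP
  [exists x : F, (quad_char x == e) && (quad_char (x + d) == f)]; first by exists x.
case/eqP: hN.
pose G x := (1 + e * quad_char x) * (1 + f * quad_char (x + d)).
have <- : \sum_x G x = #|F|%:Z - e * f.
  have -> : \sum_x G x = \sum_(x : F) 1 + e * (\sum_(x : F) quad_char x)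
     + f * (\sum_x quad_char (x + d)) + e * f * \sum_x quad_char x * quad_char (x + d).
    by rewrite !mulr_sumr -!big_split /=; apply: eq_bigr => x _; rewrite /G; ring.
  rewrite sum_quad_char_shift // sum_quad_char //.
  have <- : \sum_(x : F) quad_char x = \sum_x quad_char (x + d).
    exact: (reindex_inj (addIr d)).
  by rewrite sum_quad_char // sumr_const natz !mulr0 !addr0 mulrN1.
rewrite (bigD1 0) //= (bigD1 (- d)) ?oppr_eq0 //= big1 ?addr0 => [|x /andP[x0 xd]].
  by rewrite /G !quad_char0 add0r addNr quad_char0; lia.
have xd0 : x + d != 0 by rewrite addr_eq0.
have := hno x; rewrite /G.
by case: (quad_char_sign x0) => ->; case: (quad_char_sign xd0) => ->;
  case: he => ->; case: hf => ->.
Qed.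

(** * Quadratic reciprocity *)

Lemma eqz_mod_pchar (R : nzRingType) (p : nat) (a b : int) : p \in [char R] ->
  (a == b %[mod p])%Z = (a%:~R == b%:~R :> R).
Proof.
by move=> cp; rewrite eqz_mod_dvd (dvdz_pcharf cp) intrB subr_eq0.
Qed.

Lemma legendreE (a : int) (p : nat) : prime p -> odd p ->
  legendre a p = quad_char (a%:~R : 'F_p).
Proof.
move=> pp op; have cp := pchar_Fp pp; rewrite /legendre (dvdz_pcharf cp).
case: (eqVneq (a%:~R : 'F_p) 0) => [->|a0]; first by rewrite quad_char0.
have oF : odd #|'F_p| by rewrite card_Fp.
have -> : [exists x : 'I_p, (x%:Z ^+ 2 == a %[mod p])%Z] =
          [exists y : 'F_p, y ^+ 2 == a%:~R].
  apply/existsP/existsP => -[x xE].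
    by exists ((x : nat)%:R); move: xE; rewrite (eqz_mod_pchar _ _ cp) rmorphXn.
  have xp : (x < p)%N by rewrite -[X in (_ < X)%N](Fp_cast pp) ltn_ord.
  exists (Ordinal xp); rewrite (eqz_mod_pchar _ _ cp) rmorphXn /=.
  by rewrite -[_%:~R]/((x : nat)%:R) natr_Zp.
by rewrite -quad_char_eq1 //; case: (quad_char_sign a0) => ->.
Qed.

(** Stated in any ring of characteristic p, for use in extensions of F_p that contain roots of
    unity. *)
Lemma legendre_euler (R : nzRingType) (a : int) (p : nat) :
    prime p -> odd p -> p \in [char R] ->
  (legendre a p)%:~R = (a%:~R : R) ^+ (p.-1)./2.
Proof.
move=> pp op cR; rewrite -rmorphXn; apply/eqP.
rewrite -(eqz_mod_pchar _ _ cR) (eqz_mod_pchar _ _ (pchar_Fp pp)).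
by rewrite legendreE // quad_char_val ?card_Fp // rmorphXn.
Qed.

Lemma pchar_odd_two_neq0 (R : nzRingType) (p : nat) :
  prime p -> odd p -> p \in [char R] -> (2%:R : R) != 0.
Proof.
by move=> pp op cR; rewrite -(dvdn_pcharf cR) dvdn_prime2 //; apply: contraTneq op => ->.
Qed.

Lemma legendreM (a b : int) (p : nat) : prime p -> odd p ->
  legendre (a * b) p = legendre a p * legendre b p.
Proof. by move=> pp op; rewrite !legendreE // intrM quad_charM ?card_Fp. Qed.

Lemma legendre1 (p : nat) : prime p -> odd p -> legendre 1 p = 1.
Proof. by move=> pp op; rewrite legendreE // quad_char1. Qed.

Lemma legendre_le1 (a : int) (p : nat) : `|legendre a p| <= 1.
Proof. by rewrite /legendre; do 2?case: ifP. Qed.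

Lemma legendre_eq0 (a : int) (p : nat) : (legendre a p == 0) = (p %| a)%Z.
Proof. by rewrite /legendre; do 2?case: ifP. Qed.

Lemma legendre_sign (a : int) (p : nat) : ~~ (p %| a)%Z ->
  legendre a p = 1 \/ legendre a p = -1.
Proof. by rewrite /legendre => /negPf->; case: ifP; [left|right]. Qed.

Lemma eq_legendre (a b : int) (p : nat) : prime p -> odd p ->
  (a = b %[mod p])%Z -> legendre a p = legendre b p.
Proof.
move=> pp op /eqP; rewrite (eqz_mod_pchar _ _ (pchar_Fp pp)) => /eqP ab.
by rewrite !legendreE // ab.
Qed.

Lemma exists_order_unit (F : finFieldType) (k : nat) : (k %| #|F|.-1)%N ->
  exists u : {unit F}, #[u]%g = k.
Proof.
move=> /dvdnP[m mE]; have [u [_ ou]] := field_unit_generator F.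
have c1 : (1 < #|F|)%N := finNzRing_gt1 F.
exists (u ^+ m)%g; rewrite orderXdiv ou mE ?dvdn_mulr // mulKn //.
by move: mE; case: m => //; lia.
Qed.

(** The field with p^phi(k) elements works: k divides p^phi(k) - 1 by Euler's theorem, and the unit
    group is cyclic. *)
Lemma exists_root_of_unity (p k : nat) : prime p -> coprime p k -> (0 < k)%N ->
  exists (F : finFieldType) (u : {unit F}), p \in [char F] /\ #[u]%g = k.
Proof.
move=> pp cpk k0; have t0 : (0 < totient k)%N by rewrite totient_gt0.
have [F cF cardF] := pPrimePowerField pp t0.
have [|u ou] := @exists_order_unit F k; last by exists F, u.
rewrite cardF -subn1 -eqn_mod_dvd ?expn_gt0 ?prime_gt0 //.
by apply/eqP; exact: Euler_exp_totient.
Qed.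

Lemma order_unit_expX1 (F : finFieldType) (u : {unit F}) (k : nat) :
  (#[u]%g %| k)%N = (val u ^+ k == 1).
Proof. by rewrite order_dvdn -val_eqE /= FinRing.val_unitX. Qed.

(** * Quadratic Gauss sums with values in characteristic p *)

Section GaussSum.

Variables (p q : nat) (L : fieldType) (z : L).
Hypotheses (pr_p : prime p) (odd_p : odd p) (pr_q : prime q) (odd_q : odd q).
Hypotheses (neq_pq : p != q) (charL : p \in [char L]) (zq : z ^+ q = 1) (z1 : z != 1).

Let e (x : 'F_q) : L := z ^+ x.
Let chi (x : 'F_q) : L := (quad_char x)%:~R.
Let tau := \sum_x chi x * e x.

Let oF : odd #|'F_q|. Proof. by rewrite card_Fp. Qed.

Let e_add x y : e (x + y) = e x * e y.
Proof.
rewrite /e -exprD -(expr_mod (x + y)%N zq); congr (z ^+ _).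
by rewrite -[X in _ = (_ %% X)%N](Fp_cast pr_q).
Qed.

Let e0 : e 0 = 1. Proof. by rewrite /e expr0. Qed.

Let e_mulrn x n : e (x *+ n) = e x ^+ n.
Proof. by elim: n => [|n IH]; rewrite ?mulr0n ?e0 ?expr0 // mulrS e_add IH exprS. Qed.

(** Orthogonality: for nonzero [c] the sum is fixed by multiplication by [e 1], which is not 1. *)
Let e_sum (c : 'F_q) : \sum_x e (x * c) = if c == 0 then q%:R else 0.
Proof.
case: ifPn => [/eqP->|c0].
  under eq_bigr => x _ do rewrite mulr0 e0.
  by rewrite sumr_const card_Fp.
rewrite -(reindex_inj (mulIf c0) (P := xpredT) (F := e)) /=.
have e1 : e 1 != 1 by rewrite /e /= modn_small // ?Fp_cast ?prime_gt1 // expr1.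
apply/eqP; have : (e 1 - 1) * \sum_x e x == 0.
  rewrite mulrBl mul1r mulr_sumr subr_eq0; apply/eqP.
  rewrite [RHS](reindex_inj (addrI 1)) /=.
  by apply: eq_bigr => x _; rewrite e_add.
by rewrite mulf_eq0 subr_eq0 (negPf e1).
Qed.

Let chiM x y : chi (x * y) = chi x * chi y.
Proof. by rewrite /chi quad_charM // intrM. Qed.

(** The substitution y = x c in the second factor gives the sum over c of chi(c) times the sum over
    x of e(x (1 + c)); orthogonality keeps only c = -1. *)
Lemma gauss_sum_sqr : tau ^+ 2 = chi (-1) * q%:R.
Proof.
have step x : chi x * e x * tau = \sum_c chi c * e (x * (1 + c)).
  have [->|x0] := eqVneq x 0.
    under eq_bigr => c _ do rewrite mul0r e0 mulr1.
    by rewrite {1}/chi quad_char0 !mul0r -rmorph_sum /= sum_quad_char.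
  rewrite /tau (reindex_inj (mulfI x0)) /= mulr_sumr; apply: eq_bigr => c _.
  rewrite mulrDr mulr1 e_add chiM.
  have : chi x * chi x = 1 by rewrite /chi -intrM quad_char_sqr.
  by move=> h; rewrite -[RHS]mul1r -h; ring.
rewrite expr2 {1}/tau mulr_suml; under eq_bigr => x _ do rewrite step.
rewrite exchange_big /=; under eq_bigr => c _ do rewrite -mulr_sumr e_sum.
rewrite (bigD1 (-1)) //= subrr eqxx big1 ?addr0 // => c c1.
by rewrite addrC addr_eq0 (negPf c1) mulr0.
Qed.

(** Frobenius fixes the values of chi and sends e(x) to e(p x); then x is replaced by p x. *)
Lemma gauss_sum_frobenius : chi p%:R * tau ^+ p = tau.
Proof.
rewrite -(pFrobenius_autE charL) /tau rmorph_sum mulr_sumr /=.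
have p0 : (p%:R : 'F_q) != 0.
  by rewrite -(dvdn_pcharf (pchar_Fp pr_q)) dvdn_prime2 // eq_sym.
rewrite [RHS](reindex_inj (mulfI p0)) /=; apply: eq_bigr => x _.
rewrite rmorphM /= (pFrobenius_aut_int charL (quad_char x)) -/(chi x).
by rewrite pFrobenius_autE chiM -mulrA mulr_natl e_mulrn.
Qed.

(** [tau ^+ p.-1] is computed twice: it is chi(p) by Frobenius, and, as a power of [tau ^+ 2], a
    Legendre symbol by Euler's criterion. *)
Lemma gauss_reciprocity :
  quad_char (p%:R : 'F_q) = legendre (quad_char (-1 : 'F_q) * q%:Z) p.
Proof.
apply: (sign_inj (pchar_odd_two_neq0 pr_p odd_p charL)).
- exact: quad_char_le1.
- exact: legendre_le1.
rewrite (legendre_euler _ pr_p odd_p charL) intrM.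
have -> : (quad_char (-1 : 'F_q))%:~R * q%:Z%:~R = tau ^+ 2 by rewrite gauss_sum_sqr.
have N1 : (-1 : 'F_q) != 0 by rewrite oppr_eq0 oner_eq0.
have q0 : q%:R != 0 :> L by rewrite -(dvdn_pcharf charL) dvdn_prime2.
have t0 : tau != 0.
  suff : tau ^+ 2 != 0 by apply: contraNneq => ->; rewrite expr0n.
  rewrite gauss_sum_sqr mulf_neq0 // /chi.
  by case: (quad_char_sign N1) => ->; rewrite ?mulrNz ?oppr_eq0 oner_eq0.
rewrite -exprM; have -> : (2 * (p.-1)./2 = p.-1)%N.
  by have := odd_double_half p.-1; have := prime_gt0 pr_p; lia.
have tp : tau ^+ p = tau * tau ^+ p.-1 by rewrite -exprS prednK ?prime_gt0.
have := gauss_sum_frobenius; rewrite tp mulrCA -[RHS]mulr1 => /(mulfI t0).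
have p0 : (p%:R : 'F_q) != 0.
  by rewrite -(dvdn_pcharf (pchar_Fp pr_q)) dvdn_prime2 // eq_sym.
rewrite /chi; case: (quad_char_sign p0) => ->; first by rewrite mul1r => ->.
by rewrite mulN1r => /(canRL opprK) ->.
Qed.

End GaussSum.

(* [kappa4 n] is (-1 / n), and [kappa8 n] is (2 / n), for odd n. *)
Definition kappa4 (n : nat) : int := if (n %% 4 == 1)%N then 1 else -1.
Definition kappa8 (n : nat) : int :=
  if (n %% 8 == 1)%N || (n %% 8 == 7)%N then 1 else -1.

Lemma legendreN1 (p : nat) : prime p -> odd p -> legendre (-1) p = kappa4 p.
Proof.
move=> pp op; have cp := pchar_Fp pp.
apply: (sign_inj (pchar_odd_two_neq0 pp op cp)).
- exact: legendre_le1.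
- by rewrite /kappa4; case: ifP.
rewrite legendre_euler // mulrN1z /kappa4 -signr_odd.
have -> : odd (p.-1)./2 = ~~ (p %% 4 == 1)%N by lia.
by case: eqP.
Qed.

(** For fixed q the sign is a character of p modulo 4, which lets the signs of several q be
    collected. For p = q both sides vanish. *)
Lemma legendre_prime_reciprocity (p q : nat) :
    prime p -> odd p -> prime q -> odd q ->
  legendre q%:Z p = (if (q %% 4 == 1)%N then 1 else kappa4 p) * legendre p%:Z q.
Proof.
move=> pp op pq oq; have [<-|npq] := eqVneq p q.
  by have /eqP -> : legendre p p == 0; rewrite ?mulr0 // legendre_eq0 dvdzz.
have cqp : coprime p q by rewrite prime_coprime // dvdn_prime2.
have [L [u [cL ou]]] := exists_root_of_unity pp cqp (prime_gt0 pq).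
have zq : val u ^+ q = 1 by apply/eqP; rewrite -order_unit_expX1 ou.
have z1 : val u != 1.
  by rewrite -[val u]expr1 -order_unit_expX1 ou dvdn1 neq_ltn prime_gt1 ?orbT.
have := gauss_reciprocity pp op pq oq npq cL zq z1.
rewrite -[quad_char p%:R]/(quad_char (p%:Z%:~R : 'F_q)) -legendreE // => ->.
rewrite -[-1 : 'F_q]/((-1)%:~R) -legendreE // legendreN1 // legendreM //.
rewrite mulrA [kappa4 q]/kappa4; case: ifP => _; first by rewrite legendre1 // mul1r mul1r.
by rewrite legendreN1 // /kappa4; case: ifP => _; ring.
Qed.

Lemma legendre2 (p : nat) : prime p -> odd p -> legendre 2 p = kappa8 p.
Proof.
move=> pp op; have cp8 : coprime p 8 by rewrite (@coprimeXr 3 p 2) // coprimen2.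
have [L [u [cL ou]]] := exists_root_of_unity pp cp8 isT.
set z := val u; have zX k : (8 %| k)%N = (z ^+ k == 1) by rewrite -order_unit_expX1 ou.
have z8 : z ^+ 8 = 1 by apply/eqP; rewrite -zX.
have z4 : z ^+ 4 = -1.
  have : (z ^+ 4) ^+ 2 == 1 by rewrite -exprM z8.
  by rewrite sqrf_eq1 -zX => /orP[//|/eqP].
(* A square root of 2, since [z ^+ 7] is the inverse of [z]. Frobenius multiplies it by a sign that
   depends on p modulo 8. *)
pose y := z + z ^+ 7.
have y2 : y ^+ 2 = 2.
  have -> : y ^+ 2 = z ^+ 2 + 2 * z ^+ 8 + z ^+ 8 * z ^+ 4 * z ^+ 2 by rewrite /y; ring.
  by rewrite z8 z4; ring.
have yp : y ^+ p = (kappa8 p)%:~R * y.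
  rewrite -(pFrobenius_autE cL) /y rmorphD rmorphXn /= !pFrobenius_autE.
  rewrite -exprM -(expr_mod p z8) -(expr_mod (p * 7) z8) /kappa8.
  rewrite -modnMml.
  have : (p %% 8)%N \in [:: 1; 3; 5; 7]%N by rewrite !inE; lia.
  have e3 : z ^+ 3 = - z ^+ 7.
    by rewrite -[7%N]/(4 + 3)%N exprD z4; ring.
  have e5 : z ^+ 5 = - z by rewrite exprS z4; ring.
  by rewrite !inE => /or4P[]/eqP-> /=; rewrite -?[(_ %% 8)%N]/5%N -?[(_ %% 8)%N]/3%N ?e3 ?e5; ring.
have two0 := pchar_odd_two_neq0 pp op cL.
apply: (sign_inj two0).
- exact: legendre_le1.
- by rewrite /kappa8; case: ifP.
rewrite legendre_euler // -[2%:~R]/(2%:R : L) -y2 -exprM.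
have -> : (2 * (p.-1)./2 = p.-1)%N by have := prime_gt0 pp; lia.
have y0 : y != 0 by apply: contraNneq two0 => y0; rewrite -y2 y0 expr0n.
by apply: (mulIf y0); rewrite -yp -exprSr prednK ?prime_gt0.
Qed.

(** * The Jacobi symbol of a square-free integer *)

(** On odd [n] the two flags select among the four characters modulo 8. *)
Definition psi (b e : bool) (n : nat) : int :=
  (if b then kappa4 n else 1) * (if e then kappa8 n else 1).

Lemma modn8_odd (n : nat) : odd n -> (n %% 8)%N \in [:: 1; 3; 5; 7]%N.
Proof. by rewrite !inE; lia. Qed.

Lemma psi_mod8 (b e : bool) (n : nat) : psi b e (n %% 8) = psi b e n.
Proof. by rewrite /psi /kappa4 /kappa8 modn_mod (@modn_dvdm 8 n 4). Qed.

Lemma psiM (b e : bool) (m n : nat) : odd m -> odd n ->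
  psi b e (m * n) = psi b e m * psi b e n.
Proof.
move=> /modn8_odd hm /modn8_odd hn.
rewrite -psi_mod8 -modnMm -[psi _ _ m]psi_mod8 -[psi _ _ n]psi_mod8.
move: hm hn; rewrite !inE.
by do 2![case/or4P => /eqP->]; case: b; case: e.
Qed.

Lemma psi_sign (b e : bool) (n : nat) : psi b e n = 1 \/ psi b e n = -1.
Proof.
by rewrite /psi /kappa4 /kappa8; case: b; case: e; do 2?[case: ifP => _]; (by left) || (by right).
Qed.

(** For odd [x], the sign that reciprocity puts between (x / p) and the product of the (p / q) over
    the prime factors q of [x]; at [x] = -1 it is (-1 / p). *)
Definition twist (x : int) (p : nat) : int :=
  if (x %% 4)%Z == 1 then 1 else kappa4 p.

Lemma twistM (x y : int) (p : nat) : ~~ (2 %| x)%Z -> ~~ (2 %| y)%Z ->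
  twist (x * y) p = twist x p * twist y p.
Proof.
have odd4 (z : int) : ~~ (2 %| z)%Z -> (z %% 4)%Z \in [:: 1; 3].
  by rewrite !inE; lia.
move=> /odd4 hx /odd4 hy; rewrite /twist -modzMml -modzMmr.
move: hx hy; rewrite !inE /kappa4.
by do 2![case/orP => /eqP->] => //=; case: ifP.
Qed.

Lemma prod_odd_seq (s : seq nat) : all odd s -> ~~ (2 %| \prod_(q <- s) q%:Z)%Z.
Proof.
elim: s => [|q s IH] /=; first by rewrite big_nil.
by move=> /andP[oq /IH]; rewrite big_cons !dvdzE abszM !dvdn2 oddM oq.
Qed.

Lemma legendre_prod_primes (p : nat) (s : seq nat) : prime p -> odd p ->
    all prime s -> all odd s ->
  legendre (\prod_(q <- s) q%:Z) p =
  twist (\prod_(q <- s) q%:Z) p * \prod_(q <- s) legendre p q.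
Proof.
move=> pp op; elim: s => [|q s IH] /=; first by rewrite !big_nil legendre1.
move=> /andP[pq ps] /andP[oq os]; rewrite !big_cons legendreM // IH //.
rewrite twistM ?prod_odd_seq //; last by lia.
rewrite (legendre_prime_reciprocity pp op pq oq) [twist q%:Z _]/twist.
have -> : ((q%:Z %% 4)%Z == 1) = (q %% 4 == 1)%N by lia.
by ring.
Qed.

(** Normal form of a square-free integer, with [s] the list of its odd primes; see [sf_intP]. *)
Definition sf_int (sgn e : bool) (s : seq nat) : int :=
  (-1) ^+ sgn * 2 ^+ e * \prod_(q <- s) q%:Z.

(** The signed odd part is 1 or 3 modulo 4 when [s] consists of odd numbers; the flag marks the
    residue 3 and serves as [b] in [psi]. *)
Definition odd_part_3mod4 (sgn : bool) (s : seq nat) : bool :=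
  ((-1) ^+ sgn * \prod_(q <- s) q%:Z %% 4)%Z != 1.

Lemma legendre_sf_int (sgn e : bool) (s : seq nat) (p : nat) :
    prime p -> odd p -> all prime s -> all odd s ->
  legendre (sf_int sgn e s) p =
  psi (odd_part_3mod4 sgn s) e p * \prod_(q <- s) legendre p q.
Proof.
move=> pp op ps os; rewrite /sf_int !legendreM // legendre_prod_primes //.
have -> : legendre (2 ^+ e) p = if e then kappa8 p else 1.
  by case: e; rewrite ?expr1 ?legendre2 // expr0 legendre1.
have -> : legendre ((-1) ^+ sgn) p = twist ((-1) ^+ sgn) p.
  by case: sgn; rewrite ?expr1 ?legendreN1 // expr0 legendre1.
rewrite /psi /odd_part_3mod4 if_neg -/(twist _ _) twistM ?prod_odd_seq //.
  by ring.
by case: sgn.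
Qed.

Lemma prod_primes_logn (n : nat) : (0 < n)%N ->
  (\prod_(p <- primes n) p ^ logn p n)%N = n.
Proof. by move=> n0; rewrite [RHS]prod_prime_decomp // prime_decompE big_map. Qed.

(** Passes from primes to odd [n]: a multiplicative function that agrees with the Legendre symbol at
    odd primes is the Jacobi symbol. *)
Lemma prod_primes_morph (f : nat -> int) (n : nat) : f 1%N = 1 ->
    (forall x y, odd x -> odd y -> f (x * y)%N = f x * f y) -> odd n ->
  \prod_(p <- primes n) f p ^+ logn p n = f n.
Proof.
move=> f1 fM on; have n0 : (0 < n)%N by case: n on.
rewrite -[in RHS](prod_primes_logn n0).
have fX p k : odd p -> f (p ^ k)%N = f p ^+ k.
  by move=> op; elim: k => [|k IH]; rewrite ?expr0 // expnS fM ?oddX ?op ?orbT // IH exprS.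
have : all odd (primes n).
  apply/allP => p; rewrite mem_primes => /and3P[pp _ pn].
  by apply: dvdn_odd on.
elim: (primes n) => [|p s IH] /=; first by rewrite !big_nil f1.
move=> /andP[op os]; rewrite !big_cons fM ?IH ?fX ?oddX ?op ?orbT //.
by elim: s os {IH} => [|q s IH] /=; rewrite ?big_nil // => /andP[oq /IH];
  rewrite big_cons oddM oddX oq orbT.
Qed.

Lemma primes_odd (n p : nat) : odd n -> p \in primes n -> prime p /\ odd p.
Proof.
by move=> on; rewrite mem_primes => /and3P[pp _ pn]; split => //; apply: dvdn_odd on.
Qed.

Lemma jacobi_sf_int (sgn e : bool) (s : seq nat) (n : nat) : odd n ->
    all prime s -> all odd s ->
  jacobi (sf_int sgn e s) n =
  psi (odd_part_3mod4 sgn s) e n * \prod_(q <- s) legendre n q.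
Proof.
move=> on ps os; set b := odd_part_3mod4 sgn s.
pose f m := psi b e m * \prod_(q <- s) legendre m%:Z q.
rewrite -[RHS]/(f n) -(@prod_primes_morph f) //.
- rewrite /jacobi big_seq [RHS]big_seq; apply: eq_bigr => p /(primes_odd on)[pp op].
  by rewrite legendre_sf_int.
- rewrite /f big_seq big1 ?mulr1; first by rewrite /psi; case: (b); case: (e).
  by move=> q qs; rewrite legendre1 // ?(allP ps) ?(allP os).
- move=> x y ox oy; rewrite /f psiM // PoszM.
  have -> : \prod_(q <- s) legendre (x%:Z * y%:Z) q =
    \prod_(q <- s) legendre x q * \prod_(q <- s) legendre y q.
    rewrite -big_split /= big_seq [RHS]big_seq; apply: eq_bigr => q qs.
    by rewrite legendreM // ?(allP ps) ?(allP os).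
  by ring.
Qed.

Lemma jacobiM (a b : int) (n : nat) : odd n ->
  jacobi (a * b) n = jacobi a n * jacobi b n.
Proof.
move=> on; rewrite /jacobi -big_split /= big_seq [RHS]big_seq.
by apply: eq_bigr => p /(primes_odd on)[pp op]; rewrite legendreM // exprMn.
Qed.

Lemma jacobi_le1 (a : int) (n : nat) : `|jacobi a n| <= 1.
Proof.
rewrite /jacobi; elim/big_ind: _ => // [x y hx hy|p _].
  by rewrite normrM mulr_ile1.
by rewrite normrX exprn_ile1 ?legendre_le1.
Qed.

Lemma jacobi_neq0 (a : int) (n : nat) :
  (forall p, prime p -> (p %| n)%N -> ~~ (p %| a)%Z) -> jacobi a n != 0.
Proof.
move=> h; rewrite /jacobi prodf_seq_neq0; apply/allP => p /=.
rewrite mem_primes => /and3P[pp _ pn].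
by rewrite expf_neq0 // legendre_eq0 h.
Qed.

Lemma sf_intP (a : int) : squarefree a -> exists (sgn e : bool) (s : seq nat),
  [/\ a = sf_int sgn e s, all prime s, all odd s & uniq s].
Proof.
move=> sa; have a0 : a != 0 by apply/eqP => a0; have := sa 2; rewrite a0 dvdz0 => /(_ isT).
have n0 : (0 < `|a|)%N by rewrite absz_gt0.
have l1 p : p \in primes `|a| -> logn p `|a| = 1%N.
  move=> pa; have l0 : (0 < logn p `|a|)%N by rewrite logn_gt0.
  move: pa; rewrite mem_primes => /and3P[pp _ _].
  case: (ltngtP (logn p `|a|) 1) => // [|l2]; first by rewrite ltnNge l0.
  have := sa p; rewrite dvdzE abszX absz_nat /=.
  rewrite pfactor_dvdn // => /(_ l2); have := prime_gt1 pp; lia.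
have aE : (\prod_(p <- primes `|a|) p)%N = `|a|%N.
  rewrite -[RHS]prod_primes_logn // big_seq [RHS]big_seq.
  by apply: eq_bigr => p /l1 ->; rewrite expn1.
exists (a < 0), (2 \in primes `|a|), [seq p <- primes `|a| | odd p]; split.
- rewrite {1}(intEsign a) /sf_int -mulrA; congr (_ * _); rewrite -{1}aE.
  rewrite big_filter (bigID odd) /= mulnC PoszM; congr (_ * _); last exact: (big_morph Posz PoszM).
  rewrite -big_filter; have [h2|/negPf h2] := boolP (2 \in primes `|a|).
    have h : perm_eq [seq p <- primes `|a| | ~~ odd p] [:: 2%N].
      apply: uniq_perm => //; first by rewrite filter_uniq ?primes_uniq.
      move=> p; rewrite mem_filter inE.
      have [->|p2] := eqVneq p 2%N; first by rewrite h2.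
      apply: contraNF p2 => /andP[ep]; rewrite mem_primes => /andP[pp _].
      by case: (even_prime pp) ep => [->|->].
    by rewrite (perm_big _ h) /= big_seq1.
  have -> : [seq p <- primes `|a| | ~~ odd p] = [::].
    apply/eqP; rewrite -[_ == _]negbK -has_filter -all_predC; apply/allP => p pa /=.
    rewrite negbK; move: (pa); rewrite mem_primes => /andP[pp _].
    by case: (even_prime pp) => // p2; move: pa; rewrite p2 h2.
  by rewrite big_nil.
- by apply/allP => p; rewrite mem_filter mem_primes => /and3P[].
- exact: filter_all.
- by rewrite filter_uniq ?primes_uniq.
Qed.

(** * Sign patterns *)

Definition is_sign (x : int) : Prop := x = 1 \/ x = -1.

Lemma is_signM (x y : int) : is_sign x -> is_sign y -> is_sign (x * y).
Proof. by move=> [->|->] [->|->]; rewrite ?mulN1r ?mul1r ?opprK; [left|right|right|left]. Qed.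

Lemma is_signN (x : int) : is_sign x -> is_sign (- x).
Proof. by move=> [->|->]; [right|left]. Qed.

Lemma is_sign_sqr (x : int) : is_sign x -> x * x = 1.
Proof. by move=> [->|->]. Qed.

Definition pattern_at (d q : nat) (x y : int) : Prop :=
  exists r : nat, legendre r q = x /\ legendre (r + d)%N q = y.

Lemma pattern_of_quad_char (d q : nat) (x y : int) : prime q -> odd q ->
    (exists z : 'F_q, quad_char z = x /\ quad_char (z + d%:R) = y) ->
  pattern_at d q x y.
Proof.
move=> pq oq [z [<- <-]]; exists z; rewrite !legendreE //.
by rewrite -![_%:~R]/(_%:R) natrD natr_Zp.
Qed.

Lemma pattern_dvd (d q : nat) (x : int) : prime q -> odd q -> (q %| d)%N ->
  is_sign x -> pattern_at d q x x.
Proof.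
move=> pq oq qd sx; apply: pattern_of_quad_char => //.
have -> : d%:R = 0 :> 'F_q by apply/eqP; rewrite -(dvdn_pcharf (pchar_Fp pq)).
case: sx => ->; first by exists 1; rewrite addr0 quad_char1.
have [|z _ zN] := @quad_char_nonresidue 'F_q; first by rewrite card_Fp.
by exists z; rewrite addr0.
Qed.

Lemma pattern_exists (d q : nat) : prime q -> odd q ->
  exists x y : int, [/\ is_sign x, is_sign y & pattern_at d q x y].
Proof.
move=> pq oq; case: (boolP (q %| d)%N) => qd.
  by exists 1, 1; split; [left|left|apply: pattern_dvd => //; left].
(* The residue [d] works, since d and 2d are both nonzero modulo q. *)
exists (legendre d q), (legendre (d + d)%N q); split; last by exists d.
  by apply: legendre_sign; rewrite dvdzE !absz_nat.
apply: legendre_sign; rewrite dvdzE !absz_nat addnn -mul2n Euclid_dvdM // negb_or qd.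
by rewrite dvdn_prime2 // andbT; apply: contraTneq oq => ->.
Qed.

(** In [quad_char_pattern] the left side is at least 6 and the right side at most 4. *)
Lemma pattern_ge7 (d q : nat) (x y : int) : prime q -> (7 <= q)%N ->
  ~~ (q %| d)%N -> is_sign x -> is_sign y -> pattern_at d q x y.
Proof.
move=> pq q7 qd sx sy; have oq : odd q by case: (even_prime pq) q7 => [->|].
have d0 : (d%:R : 'F_q) != 0 by rewrite -(dvdn_pcharf (pchar_Fp pq)).
have d0' : - (d%:R : 'F_q) != 0 by rewrite oppr_eq0.
apply: pattern_of_quad_char => //; apply: quad_char_pattern; rewrite ?card_Fp //.
case: (quad_char_sign d0) (quad_char_sign d0') => -> [] ->;
  by case: sx sy => -> [] ->; lia.
Qed.

(** As -1 is a square modulo 5, chi(-d) = chi(d) = c, and 5 - e f = 2 + (e + f) c holds only for e =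
    f = c. *)
Lemma pattern5 (d : nat) (x y : int) : ~~ (5 %| d)%N -> is_sign x -> is_sign y ->
  ~ (x = legendre d 5 /\ y = legendre d 5) -> pattern_at d 5 x y.
Proof.
move=> d5 sx sy hxy; have p5 : prime 5 by [].
have d0 : (d%:R : 'F_5) != 0 by rewrite -(dvdn_pcharf (pchar_Fp p5)).
have cE : legendre d 5 = quad_char (d%:R : 'F_5) by rewrite legendreE.
have cN : quad_char (- (d%:R : 'F_5)) = quad_char (d%:R : 'F_5).
  rewrite -mulN1r quad_charM ?card_Fp //.
  by rewrite -[-1]/((-1)%:~R) -legendreE // legendreN1 // mul1r.
apply: pattern_of_quad_char => //; apply: quad_char_pattern; rewrite ?card_Fp //.
move: hxy; rewrite cN cE.
case: (quad_char_sign d0) => ->; case: sx sy => -> [] -> h; lia.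
Qed.

Lemma legendre_modn (n q : nat) : prime q -> odd q ->
  legendre n q = legendre (n %% q)%N q.
Proof. by move=> pq oq; apply: eq_legendre => //; rewrite !modz_nat modn_mod. Qed.

Lemma legendre_mod3 (n : nat) : legendre n 3 =
  if (n %% 3 == 0)%N then 0 else if (n %% 3 == 1)%N then 1 else -1.
Proof.
rewrite legendre_modn //; have : (n %% 3 < 3)%N by rewrite ltn_pmod.
case: (n %% 3)%N => [|[|[|//]]] _ /=; first by apply/eqP; rewrite legendre_eq0.
  by rewrite legendre1.
by rewrite legendre2.
Qed.

Lemma legendre_mod5 (n : nat) : legendre n 5 =
  if (n %% 5 == 0)%N then 0
  else if (n %% 5 == 1)%N || (n %% 5 == 4)%N then 1 else -1.
Proof.
rewrite legendre_modn //; have : (n %% 5 < 5)%N by rewrite ltn_pmod.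
case: (n %% 5)%N => [|[|[|[|[|//]]]]] _ /=; first by apply/eqP; rewrite legendre_eq0.
- by rewrite legendre1.
- by rewrite legendre2.
- by rewrite (@eq_legendre 3 (-1 * 2)) // legendreM // legendre2 // legendreN1.
- by rewrite (@eq_legendre 4 (-1)) // legendreN1.
Qed.

(** The residues d and 2d = -d are the two nonzero classes modulo 3. *)
Lemma pattern3 (d : nat) : ~~ (3 %| d)%N ->
  exists2 x : int, is_sign x & pattern_at d 3 x (- x).
Proof.
move=> d3; exists (legendre d 3).
  by apply: legendre_sign; rewrite dvdzE !absz_nat.
exists d; split => //; rewrite !legendre_mod3; move: d3; rewrite /dvdn -modnDm.
have : (d %% 3 < 3)%N by rewrite ltn_pmod.
by case: (d %% 3)%N => [|[|[|//]]].
Qed.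

(** * Sign patterns at the place 2 *)

Definition pattern_psi (d : nat) (b e : bool) (x y : int) : Prop :=
  exists r : nat, [/\ odd r, psi b e r = x & psi b e (r + d) = y].

Lemma modn8_even (d : nat) : ~~ odd d -> (d %% 8)%N \in [:: 0; 2; 4; 6]%N.
Proof. by rewrite !inE; lia. Qed.

Lemma pattern_psi_mod8 (d : nat) (b e : bool) (x y : int) :
  pattern_psi (d %% 8) b e x y -> pattern_psi d b e x y.
Proof.
move=> [r [or xE yE]]; exists r; split => //.
by rewrite -yE -psi_mod8 -modnDmr psi_mod8.
Qed.

(** On odd arguments a shift by 4 negates [kappa8] and keeps [kappa4], while a shift by 2 negates
    [kappa4]. The rest is a check over residues modulo 8. *)
Lemma pattern_psi_same (d : nat) (b e : bool) (x : int) : ~~ odd d -> b || e ->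
    (if e then d %% 8 != 4 else d %% 4 == 0)%N -> is_sign x ->
  pattern_psi d b e x x.
Proof.
move=> /modn8_even hd be hde sx; apply: pattern_psi_mod8.
have hde' : (if e then d %% 8 != 4 else (d %% 8) %% 4 == 0)%N.
  by rewrite (@modn_dvdm 8 d 4).
move: hd hde' be {hde}; rewrite !inE => /or4P[]/eqP->;
  case: b; case: e => // _ _; case: sx => ->;
  solve [by exists 1%N | by exists 3%N | by exists 5%N | by exists 7%N].
Qed.

Lemma pattern_psi_diff (d : nat) (b e : bool) (x : int) : ~~ odd d -> b || e ->
    (if e then d %% 8 != 0 else d %% 4 == 2)%N -> is_sign x ->
  pattern_psi d b e x (- x).
Proof.
move=> /modn8_even hd be hde sx; apply: pattern_psi_mod8.
have hde' : (if e then d %% 8 != 0 else (d %% 8) %% 4 == 2)%N.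
  by rewrite (@modn_dvdm 8 d 4).
move: hd hde' be {hde}; rewrite !inE => /or4P[]/eqP->;
  case: b; case: e => // _ _; case: sx => ->;
  solve [by exists 1%N | by exists 3%N | by exists 5%N | by exists 7%N].
Qed.

Lemma psi_mul_shift (d n : nat) (b e : bool) :
  psi b e n * psi b e (n + d) =
  psi b e (n %% 8) * psi b e ((n %% 8 + d %% 8) %% 8).
Proof. by rewrite modnDm !psi_mod8. Qed.

Lemma pattern_psi_exists (d : nat) (b e : bool) :
  exists x y : int, [/\ is_sign x, is_sign y & pattern_psi d b e x y].
Proof.
by exists (psi b e 1), (psi b e (1 + d)); split; try exact: psi_sign; exists 1%N.
Qed.

Lemma pattern_psi_trivial (d : nat) : pattern_psi d false false 1 1.
Proof. by exists 1%N. Qed.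

Lemma pattern_psi_opp (d : nat) (b e : bool) : ~~ odd d -> b || e ->
  exists x y : int, [/\ is_sign x, is_sign y, pattern_psi d b e x y &
    pattern_psi d b e (- x) (- y)].
Proof.
move=> ed be; have s1 : is_sign 1 by left.
have sN : is_sign (-1) by right.
have [h|h] := boolP (if e then d %% 8 != 4 else d %% 4 == 0)%N.
  by exists 1, 1; split => //; apply: pattern_psi_same.
have h' : (if e then d %% 8 != 0 else d %% 4 == 2)%N by case: e h {be}; lia.
by exists 1, (-1); split => //; apply: pattern_psi_diff.
Qed.

(* The residues r0 mod 8 and r q mod q are chosen independently, as the Chinese
   remainder theorem permits. *)
Definition reach (d : nat) (b e : bool) (s : seq nat) (x y : int) : Prop :=
  exists (r0 : nat) (r : nat -> nat), [/\ odd r0,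
    psi b e r0 * \prod_(q <- s) legendre (r q) q = x &
    psi b e (r0 + d) * \prod_(q <- s) legendre (r q + d)%N q = y].

Lemma reach_nil (d : nat) (b e : bool) (x y : int) :
  pattern_psi d b e x y -> reach d b e [::] x y.
Proof.
by move=> [r [or xE yE]]; exists r, id; split; rewrite ?big_nil ?mulr1.
Qed.

Lemma reach_cons (d q : nat) (b e : bool) (s : seq nat) (x y x' y' : int) :
    q \notin s -> pattern_at d q x y -> reach d b e s x' y' ->
  reach d b e (q :: s) (x * x') (y * y').
Proof.
move=> qs [t [<- <-]] [r0 [r [or <- <-]]].
exists r0, (fun p => if p == q then t else r p).
have E p : p \in s -> (p == q) = false.
  by move=> ps; apply: contraNF qs => /eqP<-.
split => //; rewrite big_cons eqxx big_seq mulrCA; congr (_ * (_ * _));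
  by rewrite [RHS]big_seq; apply: eq_bigr => p /E ->.
Qed.

Lemma reach_perm (d : nat) (b e : bool) (s s' : seq nat) (x y : int) :
  perm_eq s s' -> reach d b e s x y -> reach d b e s' x y.
Proof.
move=> ss' [r0 [r [or xE yE]]]; exists r0, r.
by rewrite -!(perm_big _ ss').
Qed.

Lemma reach_rem (d q : nat) (b e : bool) (s : seq nat) (x y x' y' : int) :
    uniq s -> q \in s -> pattern_at d q x y -> reach d b e (rem q s) x' y' ->
  reach d b e s (x * x') (y * y').
Proof.
move=> us qs pxy rs; apply: (@reach_perm _ _ _ (q :: rem q s)).
  by rewrite perm_sym perm_to_rem.
by apply: reach_cons => //; rewrite mem_rem_uniq // inE eqxx.
Qed.

(** One pattern is fixed at each prime of [s]; their product (x, y) does not depend on the choice at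
    2, which stays free. *)
Lemma reach_extend (d : nat) (b e : bool) (s : seq nat) :
    uniq s -> all prime s -> all odd s ->
  exists x y : int, [/\ is_sign x, is_sign y
   & forall u v, pattern_psi d b e u v -> reach d b e s (u * x) (v * y)].
Proof.
elim: s => [|q s IH] /=.
  move=> _ _ _; exists 1, 1; split; [by left|by left|] => u v.
  by rewrite !mulr1; exact: reach_nil.
move=> /andP[qs us] /andP[pq ps] /andP[oq os].
have [x [y [sx sy h]]] := IH us ps os.
have [z [w [sz sw pzw]]] := pattern_exists d pq oq.
exists (z * x), (w * y); split; try exact: is_signM.
by move=> u v /h; rewrite [u * (z * x)]mulrCA [v * (w * y)]mulrCA; apply: reach_cons.
Qed.

Lemma reach_exists (d : nat) (b e : bool) (s : seq nat) :
    uniq s -> all prime s -> all odd s ->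
  exists x y : int, [/\ is_sign x, is_sign y & reach d b e s x y].
Proof.
move=> us ps os; have [x [y [sx sy h]]] := reach_extend d b e us ps os.
have [u [v [su sv puv]]] := pattern_psi_exists d b e.
by exists (u * x), (v * y); split; [exact: is_signM|exact: is_signM|exact: h].
Qed.

Lemma all_rem (T : eqType) (P : pred T) (x : T) (s : seq T) :
  all P s -> all P (rem x s).
Proof. by move=> /allP h; apply/allP => y /mem_rem /h. Qed.

(** Both signs can be negated together, through the place 2 or through a prime dividing d. This gets
    around the single pattern missing at 5. *)
Lemma reach_opp (d : nat) (b e : bool) (s : seq nat) : ~~ odd d ->
    uniq s -> all prime s -> all odd s ->
    b || e || has (fun q => (q %| d)%N) s ->
  exists x y : int, [/\ is_sign x, is_sign y, reach d b e s x y &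
    reach d b e s (- x) (- y)].
Proof.
move=> ed us ps os /orP[be|/hasP[q qs qd]].
  have [x [y [sx sy h]]] := reach_extend d b e us ps os.
  have [u [v [su sv puv puv']]] := pattern_psi_opp ed be.
  exists (u * x), (v * y); split; [exact: is_signM|exact: is_signM|exact: h|].
  by rewrite -!mulNr; exact: h.
have [|||x [y [sx sy h]]] := @reach_exists d b e (rem q s).
- exact: rem_uniq.
- exact: all_rem.
- exact: all_rem.
have pd := @pattern_dvd d q _ (allP ps _ qs) (allP os _ qs) qd.
exists x, y; split=> //; rewrite -?[- x]mulN1r -?[- y]mulN1r.
  by rewrite -[x]mul1r -[y]mul1r; apply: reach_rem h => //; apply: pd; left.
by apply: reach_rem h => //; apply: pd; right.
Qed.

Lemma reach_all_dvd (d : nat) (b e : bool) (s : seq nat) (u v : int) :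
    uniq s -> all prime s -> all odd s -> all (fun q => (q %| d)%N) s ->
  pattern_psi d b e u v -> reach d b e s u v.
Proof.
elim: s => [|q s IH] /=; first by move=> _ _ _ _; exact: reach_nil.
move=> /andP[qs us] /andP[pq ps] /andP[oq os] /andP[qd ds] puv.
rewrite -[u]mul1r -[v]mul1r; apply: reach_cons => //; last exact: IH.
by apply: pattern_dvd => //; left.
Qed.

Lemma prod_sign_odd (sgn : bool) (s : seq nat) : all odd s ->
  ~~ (2 %| (-1) ^+ sgn * \prod_(q <- s) q%:Z)%Z.
Proof.
by move/prod_odd_seq; rewrite !dvdzE abszM !dvdn2 oddM; case: sgn.
Qed.

Lemma sf_int_mod4 (sgn e : bool) (s : seq nat) : all odd s ->
  (sf_int sgn e s %% 4)%Z =
  if e then 2 else if odd_part_3mod4 sgn s then 3 else 1.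
Proof.
move=> /(prod_sign_odd sgn); rewrite /odd_part_3mod4 /sf_int.
rewrite -mulrA [2 ^+ e * _]mulrC mulrA; set z := (_ * _).
by case: e => /=; rewrite ?expr1 ?expr0 ?mulr1; [lia|case: eqP => /=; lia].
Qed.

Lemma dvdn_prod_primes (s : seq nat) (d : nat) : uniq s -> all prime s ->
  (\prod_(q <- s) q %| d)%N = all (fun q => (q %| d)%N) s.
Proof.
elim: s => [|q s IH] /=; first by rewrite big_nil dvd1n.
move=> /andP[qs us] /andP[pq ps]; rewrite big_cons Gauss_dvd ?IH //.
elim: s qs ps {IH us} => [|p s IH] /=; first by rewrite big_nil coprimen1.
rewrite inE negb_or => /andP[qp qs] /andP[pp ps]; rewrite big_cons coprimeMr IH //.
by rewrite prime_coprime // dvdn_prime2 // qp.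
Qed.

(** The factor 2 divides the even [d] in any case, so only the odd primes matter. *)
Lemma sf_int_dvd (sgn e : bool) (s : seq nat) (d : nat) : ~~ odd d ->
    uniq s -> all prime s -> all odd s ->
  (sf_int sgn e s %| d%:Z)%Z = all (fun q => (q %| d)%N) s.
Proof.
move=> ed us ps os; rewrite dvdzE /sf_int !abszM !abszX absz_nat.
have -> : `|(\prod_(q <- s) q%:Z)%R|%N = (\prod_(q <- s) q)%N.
  by rewrite -(big_morph Posz PoszM (erefl _)).
have -> : (`|-1%R| ^ sgn = 1)%N by case: sgn.
rewrite mul1n Gauss_dvd ?dvdn_prod_primes //.
  by case: e; rewrite ?expn0 ?dvd1n // expn1 dvdn2 ed.
case: e; rewrite ?expn0 ?coprime1n // expn1 coprime2n.
by elim: s os {us ps} => [|q s IH] /=; rewrite ?big_nil // => /andP[oq /IH]; rewrite big_cons oddM oq.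
Qed.

(** * Reaching (-1, -1) outside the exceptional cases *)

Lemma prime_lt7 (q : nat) : prime q -> odd q -> (q < 7)%N -> q = 3%N \/ q = 5%N.
Proof. by do 7?[case: q => [|q] //]; auto. Qed.

(** The cases are, in order: a prime q >= 7 of [s] not dividing d; 5 in [s] not dividing d; 3 in [s]
    not dividing d; all primes of [s] dividing d. *)
Lemma reach_nonexceptional (sgn e : bool) (s : seq nat) (d : nat) : ~~ odd d ->
    uniq s -> all prime s -> all odd s ->
    sf_int sgn e s <> 1 -> ~ exceptional d (sf_int sgn e s) ->
  reach d (odd_part_3mod4 sgn s) e s (-1) (-1).
Proof.
move=> ed us ps os n1 nexc; have mod4 := sf_int_mod4 sgn e os.
set b := odd_part_3mod4 sgn s in mod4 *.
have rem_ok q : [/\ uniq (rem q s), all prime (rem q s) & all odd (rem q s)].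
  by split; [exact: rem_uniq|exact: all_rem|exact: all_rem].
(* It suffices that q supplies the negative of a pattern reached by the other places. *)
have fin q x y : q \in s -> reach d b e (rem q s) x y -> is_sign x -> is_sign y ->
    pattern_at d q (- x) (- y) -> reach d b e s (-1) (-1).
  move=> qs rq sx sy pq; have := reach_rem us qs pq rq.
  by rewrite !mulNr !is_sign_sqr.
have [/hasP[q qs /andP[q7 qd]]|/hasPn h7] :=
    boolP (has (fun q => (6 < q) && ~~ (q %| d))%N s).
  have [u' p' o'] := rem_ok q; have [x [y [sx sy rxy]]] := reach_exists d b e u' p' o'.
  apply: (fin _ _ _ qs rxy sx sy).
  by apply: pattern_ge7; rewrite ?(allP ps) //; apply: is_signN.
have small q : q \in s -> ~~ (q %| d)%N -> q = 3%N \/ q = 5%N.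
  move=> qs qd; apply: prime_lt7; rewrite ?(allP ps) ?(allP os) //.
  by have := h7 q qs; rewrite qd andbT -leqNgt.
have [/andP[s5 d5]|h5] := boolP ((5 \in s) && ~~ (5 %| d))%N.
  have [u' p' o'] := rem_ok 5%N; set c := legendre d 5.
  have sc : is_sign c by apply: legendre_sign; rewrite dvdzE !absz_nat.
  have fin5 x y : reach d b e (rem 5%N s) x y -> is_sign x -> is_sign y ->
      ~ (- x = c /\ - y = c) -> reach d b e s (-1) (-1).
    move=> rxy sx sy nc; apply: (fin _ _ _ s5 rxy sx sy).
    by apply: pattern5 => //; apply: is_signN.
  (* If the other places reach (x, y) and (-x, -y), at most one of the two patterns then required at
     5 is the missing (c, c). *)
  have [h|] := boolP (b || e || has (fun q => (q %| d)%N) (rem 5%N s)).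
    have [x [y [sx sy r1 r2]]] := reach_opp ed u' p' o' h.
    have [/andP[/eqP xc /eqP yc]|nc] := boolP ((- x == c) && (- y == c)).
      apply: (fin5 _ _ r2 (is_signN sx) (is_signN sy)).
      by rewrite xc yc => -[]; case: sc => ->.
    apply: (fin5 _ _ r1 sx sy) => -[/eqP xc /eqP yc]; by rewrite xc yc in nc.
  rewrite !negb_or => /andP[/andP[/negPf b0 /negPf e0] /hasPn nd].
  (* Here psi is trivial and no prime of [s] other than 5 divides d, so only 3 can remain. *)
  have all3 q : q \in rem 5%N s -> q = 3%N.
    move=> qr; case: (small q (mem_rem qr) (nd q qr)) => //.
    by move=> q5; move: qr; rewrite q5 mem_rem_uniq // inE eqxx.
  have sE := perm_to_rem s5.
  have triv : pattern_psi d b e 1 1 by rewrite b0 e0; exact: pattern_psi_trivial.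
  have s1 : is_sign 1 by left.
  case rE : (rem 5%N s) u' all3 => [|q t] u' all3.
    (* For g0 = 5 the hypothesis excludes (d / 5) = -1, so (-1, -1) is available at 5. *)
    have g5 : sf_int sgn e s = 5.
      move: b0; rewrite /b /odd_part_3mod4 /sf_int (perm_big _ sE) rE /= big_seq1 e0.
      by case: (sgn).
    have c1 : c = 1.
      case: sc => // cN; case: nexc; apply: Or31; split => //.
      move: cN; rewrite /c legendre_mod5 => h; have : (d %% 5 < 5)%N by rewrite ltn_pmod.
      by move: h; case: (d %% 5)%N => [|[|[|[|[|]]]]] // _; [left|right].
    apply: (fin5 1 1) => //; first by rewrite rE; exact: reach_nil.
    by rewrite c1 => -[].
  have q3 : q = 3%N by apply: all3; rewrite inE eqxx.
  have t0 : t = [::].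
    case: t rE u' all3 => // p t _; rewrite q3 /= => /andP[h _] all3.
    by move: h; rewrite (all3 p) ?inE ?eqxx ?orbT.
  have d3 : ~~ (3 %| d)%N by rewrite -q3 nd // rE inE eqxx.
  (* For [s] made of 5 and 3, the unequal signs at 3 require unequal signs at 5, and these are
     available. *)
  have [x sx px] := pattern3 d3.
  apply: (fin5 x (- x)) => //; last first.
  - by rewrite opprK => -[]; case: sx => -> <-.
  - exact: is_signN.
  have := reach_cons (isT : 3%N \notin [::]) px (reach_nil triv).
  by rewrite rE q3 t0 !mulr1.
(* From here on every prime of [s] other than 3 divides d. *)
have dvd q : q \in s -> q != 3%N -> (q %| d)%N.
  move=> qs q3; apply: contraTT isT => qd; case: (small q qs qd) => qE.
    by rewrite qE in q3.
  by case/negP: h5; rewrite -qE qs qd.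
have s1 : is_sign (-1) by right.
have [/andP[s3 d3]|h3] := boolP ((3 \in s) && ~~ (3 %| d))%N.
  (* Here g0 divides 3d but not d. Non-exceptionality then provides unequal signs at 2, which
     compensate the unequal signs at 3. *)
  have nd : ~ (sf_int sgn e s %| d%:Z)%Z.
    by rewrite sf_int_dvd // => /allP /(_ _ s3); rewrite (negPf d3).
  have d3d : (sf_int sgn e s %| 3 * d%:Z)%Z.
    rewrite -[3 * d%:Z]/((3 * d)%N%:Z) sf_int_dvd ?oddM ?(negPf ed) ?andbF //.
    apply/allP => q qs; have [->|q3] := eqVneq q 3%N; first by rewrite dvdn_mulr.
    by rewrite dvdn_mull // dvd.
  have n3 : ~ [\/ (sf_int sgn e s = 1 %[mod 4])%Z,
      (sf_int sgn e s = 3 %[mod 4])%Z /\ (d = 0 %[mod 4])%N |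
      (sf_int sgn e s = 2 %[mod 4])%Z /\ (d = 0 %[mod 8])%N].
    by move=> h; apply: nexc; apply: Or33.
  rewrite mod4 in n3.
  have [x sx px] := pattern3 d3.
  have [u' p' o'] := rem_ok 3%N.
  apply: (fin _ (- x) x s3) => //; rewrite ?opprK //; try exact: is_signN.
  apply: reach_all_dvd => //.
    apply/allP => q; rewrite mem_rem_uniq // inE => /andP[q3 qs]; exact: dvd.
  rewrite -[in X in pattern_psi _ _ _ _ X](opprK x).
  have be : b || e.
    apply/negPn/negP; rewrite negb_or => /andP[/negPf b0 /negPf e0].
    by apply: n3; rewrite b0 e0; apply: Or31.
  apply: pattern_psi_diff (is_signN sx) => //.
  case: (e) (b) be n3 => [|] [] //= _ n3.
  - by apply/negP => /eqP d8; apply: n3; apply: Or33.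
  - by apply/negP => /eqP d8; apply: n3; apply: Or33.
  - suff : (d %% 4 != 0)%N by lia.
    by apply/negP => /eqP d4; apply: n3; apply: Or32.
have alld : all (fun q => (q %| d)%N) s.
  apply/allP => q qs; have [q3|] := eqVneq q 3%N; last exact: dvd.
  by move: h3; rewrite negb_and -q3 qs /= negbK.
(* Now g0 divides d; if psi is not trivial, non-exceptionality makes (-1, -1) available at 2. *)
have n2 : ~ ((d = 2 %[mod 4])%N /\ (sf_int sgn e s = 3 %[mod 4])%Z \/
   (d = 4 %[mod 8])%N /\ (sf_int sgn e s = 2 %[mod 4])%Z).
  by move=> h; apply: nexc; apply: Or32; split => //; rewrite sf_int_dvd.
rewrite mod4 in n2; have [be|] := boolP (b || e).
  apply: reach_all_dvd => //; apply: pattern_psi_same => //.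
  case: (e) (b) be n2 => [|] [] //= _ n2.
  - by apply/negP => /eqP d8; apply: n2; right.
  - by apply/negP => /eqP d8; apply: n2; right.
  - suff : (d %% 4 != 2)%N by lia.
    by apply/negP => /eqP d4; apply: n2; left.
rewrite negb_or => /andP[/negPf b0 /negPf e0].
(* With psi trivial, g0 <> 1 provides a prime of [s], and (-1, -1) is taken there. *)
case sE : s => [|q t].
  case: n1; move: b0; rewrite /b /odd_part_3mod4 /sf_int sE big_nil e0.
  by case: (sgn).
have qs : q \in s by rewrite sE inE eqxx.
rewrite -sE; have [u' p' o'] := rem_ok q.
apply: (fin q 1 1 qs); try by left.
  by apply: reach_all_dvd; rewrite ?all_rem // b0 e0; exact: pattern_psi_trivial.
by apply: pattern_dvd; rewrite ?(allP ps) ?(allP os) ?(allP alld).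
Qed.

(** * Admissibility *)

(** Each induction step absorbs one prime into the modulus [m]. The bound [N] later yields
    infinitely many solutions. *)
Lemma chinese_primes (m r0 N : nat) (s : seq nat) (r : nat -> nat) :
    (0 < m)%N -> uniq s -> all prime s -> all (coprime m) s ->
  exists n : nat, [/\ (N <= n)%N, n = r0 %[mod m] &
    forall q, q \in s -> n = r q %[mod q]].
Proof.
elim: s m r0 => [|q s IH] m r0 m0 /=.
  move=> _ _ _; exists (N * m + r0)%N; split => //; last by rewrite modnMDl.
  by rewrite (leq_trans (leq_pmulr N m0)) ?leq_addr.
move=> /andP[qs us] /andP[pq ps] /andP[cq cs].
have [||||n [Nn nm ns]] := IH (m * q)%N (chinese m q r0 (r q)).
- by rewrite muln_gt0 m0 prime_gt0.
- exact: us.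
- exact: ps.
- apply/allP => p p_s; rewrite coprimeMl (allP cs) // prime_coprime //.
  rewrite dvdn_prime2 //; last exact: (allP ps).
  by apply: contraNneq qs => ->.
exists n; split => //.
  rewrite -[LHS](modn_dvdm n (dvdn_mulr q (dvdnn m))) nm.
  by rewrite (modn_dvdm _ (dvdn_mulr q (dvdnn m))) chinese_modl.
move=> p; rewrite inE => /predU1P[->|/ns//].
rewrite -[LHS](modn_dvdm n (dvdn_mull m (dvdnn q))) nm.
by rewrite (modn_dvdm _ (dvdn_mull m (dvdnn q))) chinese_modr.
Qed.

Lemma infinite_set_nat (A : set nat) :
  (forall N, exists2 n, (N <= n)%N & A n) -> infinite_set A.
Proof.
move=> h /finite_seqP[s sE]; have [n Nn] := h (\max_(i <- s) i).+1.
rewrite sE /= => ns; move: Nn; rewrite ltnNge.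
by rewrite (@leq_bigmax_seq _ _ xpredT id).
Qed.

Lemma jacobi_sqr_factor (a b : int) (n : nat) : odd n ->
  (forall p, prime p -> (p %| n)%N -> ~~ (p %| b)%Z) ->
  jacobi (a * b ^+ 2) n = jacobi a n.
Proof.
move=> on /jacobi_neq0 nz; rewrite expr2 !jacobiM //.
have := jacobi_le1 b n; move: nz; set j := jacobi b n => nz le1.
have : j = 1 \/ j = -1 by lia.
by case=> ->; rewrite ?mulrNN !mulr1.
Qed.

(** The value -1 already rules out a zero symbol of [b], so its square is 1. *)
Lemma jacobi_sqr_factorN1 (a b : int) (n : nat) : odd n ->
  jacobi (a * b ^+ 2) n = -1 -> jacobi a n = -1.
Proof.
move=> on; rewrite expr2 !jacobiM //.
have := jacobi_le1 b n; set j := jacobi b n => le1.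
have : j = 0 \/ j * j = 1.
  have : j = 0 \/ j = 1 \/ j = -1 by lia.
  by case=> [->|[->|->]]; [left|right|right].
by case=> ->; rewrite ?mulr0 // mulr1.
Qed.

Lemma admissible_of_reach (sgn e : bool) (s : seq nat) (gs : int) (d : nat) :
    ~~ odd d -> gs != 0 -> uniq s -> all prime s -> all odd s ->
    reach d (odd_part_3mod4 sgn s) e s (-1) (-1) ->
  artin_admissible d (sf_int sgn e s * gs ^+ 2).
Proof.
move=> ed gs0 us ps os [r0 [r [or0 xE yE]]].
apply: infinite_set_nat => N.
(* The odd primes of [gs] outside [s]: neither n nor n + d may be divisible by them. *)
pose t := [seq q <- primes `|gs| | odd q && (q \notin s)].
(* Outside [s], n and n + d become 1 and 1 modulo q, or d and 2d; all are nonzero since q is odd. *)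
pose r' q := if q \in s then r q else if (q %| d)%N then 1%N else d.
have ust : uniq (s ++ t).
  rewrite cat_uniq us filter_uniq ?primes_uniq // andbT -all_predC.
  by apply/allP => q; rewrite mem_filter => /andP[/andP[]].
have pst : all prime (s ++ t).
  rewrite all_cat ps; apply/allP => q; rewrite mem_filter mem_primes.
  by case/andP => _ /and3P[].
have ost : all odd (s ++ t).
  by rewrite all_cat os; apply/allP => q; rewrite mem_filter => /andP[/andP[]].
have cst : all (coprime 8) (s ++ t).
  by apply/allP => q /(allP ost) oq; rewrite (@coprimeXl 3 2 q) // coprime2n.
have [n [Nn n8 nq]] := chinese_primes r0 N r' (isT : 0 < 8)%N ust pst cst.
have on : odd n by lia.
have ond : odd (n + d) by rewrite oddD on (negPf ed).
have psiE m :
    psi (odd_part_3mod4 sgn s) e (n + m) = psi (odd_part_3mod4 sgn s) e (r0 + m).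
  by rewrite -psi_mod8 -modnDml n8 modnDml psi_mod8.
have prodE m : \prod_(q <- s) legendre (n + m)%N q =
    \prod_(q <- s) legendre (r q + m)%N q.
  rewrite big_seq [RHS]big_seq; apply: eq_bigr => q qs.
  rewrite legendre_modn ?(allP ps) ?(allP os) // -modnDml nq ?mem_cat ?qs //.
  by rewrite /r' qs modnDml -legendre_modn ?(allP ps) ?(allP os).
have J0 : jacobi (sf_int sgn e s) n = -1.
  rewrite jacobi_sf_int // -xE.
  have := prodE 0%N; have := psiE 0%N.
  by rewrite !addn0 => -> ->; under eq_bigr => q _ do rewrite addn0.
have Jd : jacobi (sf_int sgn e s) (n + d) = -1.
  by rewrite jacobi_sf_int // -yE psiE prodE.
have nz m : odd (n + m) -> jacobi (sf_int sgn e s) (n + m) = -1 ->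
    (m = 0)%N \/ m = d ->
    forall p, prime p -> (p %| n + m)%N -> ~~ (p %| gs)%Z.
  move=> onm Jm hm p pp pnm; apply/negP; rewrite dvdzE absz_nat => pgs.
  have op : odd p by apply: dvdn_odd onm.
  (* A prime of [s] dividing [n + m] would make the Jacobi symbol 0 instead of -1. *)
  have [p_s|p_s] := boolP (p \in s).
    move: Jm; rewrite jacobi_sf_int // (big_rem p) //=.
    have /eqP -> : legendre (n + m)%N p == 0 by rewrite legendre_eq0 dvdzE !absz_nat.
    by rewrite mul0r mulr0.
  have pt : p \in s ++ t.
    by rewrite mem_cat mem_filter mem_primes p_s op pp absz_gt0 gs0 pgs orbT.
  have := pnm; rewrite /dvdn -modnDml nq // modnDml /r' (negPf p_s) -/(dvdn _ _).
  have p2 : (2 < p)%N by rewrite ltn_neqAle prime_gt1 // andbT; apply: contraTneq op => <-.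
  case: ifP => pd.
    have -> : (p %| 1 + m)%N = (p %| 1)%N.
      by rewrite dvdn_addl //; case: hm => ->.
    by rewrite dvdn1; apply/negP; lia.
  case: hm => ->; rewrite ?addn0 ?pd //.
  by rewrite addnn -mul2n Euclid_dvdM // pd orbF dvdn_prime2 //; lia.
exists n => //; split => //; rewrite /Delta.
rewrite !jacobi_sqr_factor ?J0 ?Jd //; first by apply: nz => //; right.
by have := nz 0%N; rewrite addn0; apply => //; left.
Qed.

(** * Obstructions in the exceptional cases *)

Lemma legendre_mul_shift_dvd (n d q : nat) : prime q -> odd q -> (q %| d)%N ->
  legendre n q != 0 -> legendre n q * legendre (n + d)%N q = 1.
Proof.
move=> pq oq qd; rewrite legendre_eq0 => nz.
have -> : legendre (n + d)%N q = legendre n q.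
  by rewrite legendre_modn // [RHS]legendre_modn // -modnDmr (eqP qd) addn0.
by case: (legendre_sign nz) => ->.
Qed.

Lemma legendre_mul_shift_3 (n d : nat) : ~~ (3 %| d)%N ->
    legendre n 3 != 0 -> legendre (n + d)%N 3 != 0 ->
  legendre n 3 * legendre (n + d)%N 3 = -1.
Proof.
rewrite !legendre_mod3 /dvdn -modnDm.
have : (d %% 3 < 3)%N by rewrite ltn_pmod.
have : (n %% 3 < 3)%N by rewrite ltn_pmod.
by case: (n %% 3)%N => [|[|[|//]]]; case: (d %% 3)%N => [|[|[|//]]].
Qed.

Lemma psi_shift_diff (d n : nat) (b e : bool) : odd n ->
    (if e then d %% 8 == 4 else b && (d %% 4 == 2))%N ->
  psi b e n * psi b e (n + d) = -1.
Proof.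
move=> /modn8_odd on h; rewrite psi_mul_shift.
have : (if e then d %% 8 == 4 else b && ((d %% 8) %% 4 == 2))%N.
  by rewrite (@modn_dvdm 8 d 4).
have : (d %% 8 < 8)%N by rewrite ltn_pmod.
move: on; rewrite !inE => /or4P[]/eqP->;
  by case: e {h}; case: b => //; case: (d %% 8)%N => [|[|[|[|[|[|[|[|//]]]]]]]].
Qed.

Lemma psi_shift_same (d n : nat) (b e : bool) : odd n ->
    (if e then d %% 8 == 0 else b ==> (d %% 4 == 0))%N ->
  psi b e n * psi b e (n + d) = 1.
Proof.
move=> /modn8_odd on h; rewrite psi_mul_shift.
have : (if e then d %% 8 == 0 else b ==> ((d %% 8) %% 4 == 0))%N.
  by rewrite (@modn_dvdm 8 d 4).
have : (d %% 8 < 8)%N by rewrite ltn_pmod.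
move: on; rewrite !inE => /or4P[]/eqP->;
  by case: e {h}; case: b => //; case: (d %% 8)%N => [|[|[|[|[|[|[|[|//]]]]]]]].
Qed.

(** By reciprocity (5 / n) = (n / 5), and the nonresidues 2 and 3 modulo 5 never differ by 2 or
    3. *)
Lemma jacobi_exceptional5 (d n : nat) : odd n -> ~~ odd d ->
    (d = 2 %[mod 5] \/ d = 3 %[mod 5])%N ->
  ~ (jacobi 5 n = -1 /\ jacobi 5 (n + d) = -1).
Proof.
move=> on ed hd; have ond : odd (n + d) by rewrite oddD on (negPf ed).
have -> : 5 = sf_int false false [:: 5%N] by rewrite /sf_int big_seq1.
have b0 : odd_part_3mod4 false [:: 5%N] = false by rewrite /odd_part_3mod4 big_seq1.
rewrite !jacobi_sf_int // b0 !big_seq1 !mul1r !legendre_mod5 -modnDm.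
have : (n %% 5 < 5)%N by rewrite ltn_pmod.
by case: hd => ->; case: (n %% 5)%N => [|[|[|[|[|//]]]]] _ [].
Qed.

(** Two symbols equal to -1 have product 1, which splits into one factor per place; no factor at a
    prime of [s] vanishes. *)
Lemma jacobi_sf_int_shift (sgn e : bool) (s : seq nat) (d n : nat) : ~~ odd d ->
    all prime s -> all odd s -> odd n ->
    jacobi (sf_int sgn e s) n = -1 -> jacobi (sf_int sgn e s) (n + d) = -1 ->
  [/\ psi (odd_part_3mod4 sgn s) e n * psi (odd_part_3mod4 sgn s) e (n + d) *
      \prod_(q <- s) (legendre n q * legendre (n + d)%N q) = 1,
      forall q, q \in s -> legendre n q != 0 &
      forall q, q \in s -> legendre (n + d)%N q != 0].
Proof.
move=> ed ps os on; rewrite !jacobi_sf_int // ?oddD ?on ?(negPf ed) // => J0 Jd.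
split; first by rewrite big_split /= mulrACA J0 Jd.
  move=> q qs; apply/eqP => l0; move: J0.
  by rewrite (big_rem q) //= l0 mul0r mulr0.
move=> q qs; apply/eqP => l0; move: Jd.
by rewrite (big_rem q) //= l0 mul0r mulr0.
Qed.

(** Outside the case of 5, that product is forced to be -1: if g0 divides d, the place 2 gives -1
    and every prime gives 1; otherwise 3 gives -1 and all other places give 1. *)
Lemma jacobi_exceptional (sgn e : bool) (s : seq nat) (d n : nat) : ~~ odd d ->
    uniq s -> all prime s -> all odd s -> exceptional d (sf_int sgn e s) -> odd n ->
  ~ (jacobi (sf_int sgn e s) n = -1 /\ jacobi (sf_int sgn e s) (n + d) = -1).
Proof.
move=> ed us ps os + on; case=> [[-> hd]|hexc|hexc]; first exact: jacobi_exceptional5.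
  move=> [J0 Jd]; have [+ nz0 _] := jacobi_sf_int_shift ed ps os on J0 Jd.
  move: hexc; rewrite /exceptional_dvd sf_int_mod4 // sf_int_dvd //.
  set b := odd_part_3mod4 sgn s => -[/allP alld h].
  rewrite big_seq big1 ?mulr1 => [|q qs]; last first.
    by rewrite legendre_mul_shift_dvd ?(allP ps) ?(allP os) ?alld ?nz0.
  rewrite psi_shift_diff //; case: h => -[dE]; case: (e) => //; case: (b) => // _;
  by rewrite dE.
move=> [J0 Jd]; have [+ nz0 nzd] := jacobi_sf_int_shift ed ps os on J0 Jd.
move: hexc; rewrite /exceptional_dvd3 sf_int_mod4 // sf_int_dvd //.
set b := odd_part_3mod4 sgn s => hexc.
case: hexc => nd + h; rewrite -[3 * d%:Z]/((3 * d)%N%:Z) sf_int_dvd ?oddM ?(negPf ed) ?andbF //.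
move=> /allP d3d.
have q_dvd q : q \in s -> q != 3%N -> (q %| d)%N.
  move=> qs q3; have pq := allP ps q qs.
  by have := d3d q qs; rewrite Euclid_dvdM // dvdn_prime2 // (negPf q3).
(* Some prime of [s] does not divide d, and only 3 can be that prime. *)
have [s3 d3] : 3%N \in s /\ ~~ (3 %| d)%N.
  move/negP: nd; rewrite -has_predC => /hasP[p p_s /= pd].
  have [p3|p3] := eqVneq p 3%N; last by rewrite q_dvd in pd.
  by rewrite -p3.
rewrite (big_rem 3%N) //= big_seq big1 ?mulr1 => [|q]; last first.
  rewrite mem_rem_uniq // inE => /andP[q3 qs].
  by rewrite legendre_mul_shift_dvd ?(allP ps) ?(allP os) ?q_dvd ?nz0.
rewrite legendre_mul_shift_3 ?nz0 ?nzd // psi_shift_same //.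
by case: h => [|[]|[]]; case: (e) => //; case: (b) => // _ dE; rewrite dE.
Qed.

Lemma Delta_exceptional (sgn e : bool) (s : seq nat) (gs : int) (d n : nat) :
    ~~ odd d -> uniq s -> all prime s -> all odd s ->
    exceptional d (sf_int sgn e s) -> odd n ->
  Delta d (sf_int sgn e s * gs ^+ 2) n = 0%N.
Proof.
move=> ed us ps os hexc on; rewrite /Delta; case: ifP => // /andP[/eqP J0 /eqP Jd].
case: (jacobi_exceptional ed us ps os hexc on); split.
  exact: jacobi_sqr_factorN1 J0.
by apply: jacobi_sqr_factorN1 Jd; rewrite oddD on (negPf ed).
Qed.

(** * Primitive roots and the theorem *)

Lemma jacobi_prime (a : int) (p : nat) : prime p -> jacobi a p = legendre a p.
Proof.
by move=> pp; rewrite /jacobi primes_prime // big_seq1 (logn_prime p pp) eqxx expr1.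
Qed.

(** A square modulo p has order dividing (p - 1) / 2, whereas a generator has order p - 1. *)
Lemma legendre_artin_prime (g : int) (p : nat) : artin_primes g p -> legendre g p = -1.
Proof.
case=> pp op [u ug]; rewrite /generator => /eqP gen.
have p2 : (2 < p)%N by rewrite ltn_neqAle prime_gt1 // andbT; apply: contraTneq op => <-.
have ou : #[u]%g = p.-1 by rewrite orderE -gen card_units_Zp ?prime_gt0 // totient_prime.
have cp : p \in [char 'Z_p] by rewrite inE pp /= pchar_Zp ?eqxx // ltnW.
have uu := valP u; rewrite -/(val u) ug in uu.
rewrite /legendre; case: ifP => [pg|_].
  by move: uu; rewrite (dvdz_pcharf cp) in pg; rewrite (eqP pg) unitr0.
case: ifP => // /existsP[x xE]; exfalso.
have {}xE : ((x : nat)%:R : 'Z_p) ^+ 2 = g%:~R.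
  by apply/eqP; move: xE; rewrite (eqz_mod_pchar _ _ cp) rmorphXn.
have ux : ((x : nat)%:R : 'Z_p) \is a GRing.unit.
  by move: uu; rewrite -xE unitrX_pos.
pose v : {unit 'Z_p} := FinRing.unit _ ux.
have uv : u = (v ^+ 2)%g by apply: val_inj; rewrite FinRing.val_unitX /= xE.
have vp : (v ^+ p.-1 = 1)%g.
  rewrite -(totient_prime pp) -card_units_Zp ?prime_gt0 //.
  by apply: expg_cardG; rewrite inE.
have : (#[u]%g %| (p.-1)./2)%N.
  rewrite order_dvdn uv -expgM mul2n.
  have -> : ((p.-1)./2.*2 = p.-1)%N by lia.
  by rewrite vp.
rewrite ou => /dvdn_leq; lia.
Qed.

Theorem theorem1 (d : nat) (g g0 gs : int)
    (d_even : ~~ odd d)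
    (g_neqN1 : g <> -1)
    (g_not_power : forall (b : int) (h : nat), (2 <= h)%N -> g <> b ^+ h)
    (g0_squarefree : squarefree g0)
    (g_decomposition : g = g0 * gs ^+ 2) :
  (~ artin_admissible d g <-> exceptional d g0) /\
  (exceptional d g0 -> artin_pairs d g = classical_sets.set0).
Proof.
have [sgn [e [s [g0E ps os us]]]] := sf_intP g0_squarefree.
have gs0 : gs != 0.
  apply/eqP => gs0; apply: (g_not_power 0 2%N isT).
  by rewrite g_decomposition gs0 expr0n mulr0.
have g01 : g0 <> 1.
  by move=> g01; apply: (g_not_power gs 2%N isT); rewrite g_decomposition g01 mul1r.
have noD : exceptional d g0 -> forall n, odd n -> Delta d g n = 0%N.
  rewrite g_decomposition g0E => hexc n on; exact: Delta_exceptional.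
split; [split=> [nadm|hexc]|move=> hexc].
- apply: contrapT => nexc; apply: nadm; rewrite g_decomposition g0E.
  apply: admissible_of_reach => //; apply: reach_nonexceptional => //; by rewrite -g0E.
- apply; rewrite (_ : [set n | _]%classic = set0).
    exact: finite_set0.
  by rewrite -subset0 => n [on]; rewrite noD.
(* A pair p, p + d would have both symbols -1, hence [Delta] equal to 1 at p. *)
- rewrite -subset0 => p [pA pdA]; have [pp op _] := pA; have [pdp _ _] := pdA.
  have := noD hexc p op; rewrite /Delta !jacobi_prime //.
  by rewrite (legendre_artin_prime pA) (legendre_artin_prime pdA) eqxx.
Qed.
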